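(* Let $A$ be a $\Bbbk$-algebra with a system of local units $S=\{e_\lambda\}_{\lambda\in\Lambda}$. Then the category of unital left $A$-modules is equivalent to the category of $\mathcal{C}^S(A)$-modules.
   Context: $\Bbbk$ is a field; algebras are associative and not necessarily unital. A system of local units of $A$ is a set $S=\{e_\lambda\}_{\lambda\in\Lambda}$ of idempotents of $A$ such that for every finite subset $F\subseteq A$ there is $e_\alpha\in S$ with $e_\alpha a=ae_\alpha=a$ for all $a\in F$. A left $A$-module $M$ is unital if $AM=M$. A $\Bbbk$-category is a category whose morphism sets are $\Bbbk$-vector spaces and whose composition is $\Bbbk$-bilinear. $\mathcal{C}^S(A)$ is the $\Bbbk$-category with object set $\Lambda$, with space of morphisms from $\alpha$ to $\beta$ equal to $e_\beta Ae_\alpha$, and with composition given by the multiplication of $A$ (so the identity of $\alpha$ is $e_\alpha$). For a $\Bbbk$-category $\mathcal{C}$, a $\mathcal{C}$-module is a $\Bbbk$-linear functor from $\mathcal{C}$ to the category of $\Bbbk$-vector spaces; morphisms of $\mathcal{C}$-modules are natural transformations. *)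

(* Defs.v *)
From HB Require Import structures.
From mathcomp Require Import all_boot all_algebra.
From mathcomp Require Import boolp.

Set Implicit Arguments.
Unset Strict Implicit.
Unset Printing Implicit Defensive.

Import GRing.Theory.
Local Open Scope ring_scope.

Declare Scope category_scope.
Delimit Scope category_scope with cat.
Local Open Scope category_scope.

Record category := Category {
  obj :> Type;
  hom : obj -> obj -> Type;
  idm : forall x, hom x x;
  compm : forall x y z, hom y z -> hom x y -> hom x z;
  comp1m : forall x y (f : hom x y), compm (idm y) f = f;
  compm1 : forall x y (f : hom x y), compm f (idm x) = f;
  compmA : forall x y z t (h : hom z t) (g : hom y z) (f : hom x y),
    compm h (compm g f) = compm (compm h g) f
}.
Arguments hom {c} x y.
Arguments idm {c} x.
Arguments compm {c x y z} g f.
Notation "g '\;o' f" := (compm g f) (at level 40, left associativity)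
  : category_scope.

Definition is_iso (C : category) (x y : C) (f : hom x y) : Prop :=
  exists g : hom y x, g \;o f = idm x /\ f \;o g = idm y.

Record functor (C D : category) := Functor {
  fobj :> C -> D;
  fmap : forall x y, hom x y -> hom (fobj x) (fobj y);
  fmap1 : forall x, fmap (idm x) = idm (fobj x);
  fmapM : forall x y z (g : hom y z) (f : hom x y),
    fmap (g \;o f) = fmap g \;o fmap f
}.
Arguments fmap {C D} F {x y} f : rename.

Definition functor_id (C : category) : functor C C :=
  @Functor C C id (fun _ _ f => f) (fun _ => erefl) (fun _ _ _ _ _ => erefl).

Section FunctorComp.
Variables (C D E : category) (G : functor D E) (F : functor C D).

Lemma functor_comp_fmap1 (x : C) :
  fmap G (fmap F (idm x)) = idm (G (F x)).
Proof. by rewrite !fmap1. Qed.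

Lemma functor_comp_fmapM (x y z : C) (g : hom y z) (f : hom x y) :
  fmap G (fmap F (g \;o f)) = fmap G (fmap F g) \;o fmap G (fmap F f).
Proof. by rewrite !fmapM. Qed.

Definition functor_comp : functor C E :=
  @Functor C E (fun x => G (F x)) (fun _ _ f => fmap G (fmap F f))
    functor_comp_fmap1 functor_comp_fmapM.
End FunctorComp.

Record nattrans (C D : category) (F G : functor C D) := NatTrans {
  component :> forall x, hom (F x) (G x);
  naturality : forall x y (f : hom x y),
    fmap G f \;o component x = component y \;o fmap F f
}.

Lemma nattrans_ext (C D : category) (F G : functor C D)
  (s t : nattrans F G) : (forall x, s x = t x) -> s = t.
Proof.
case: s t => [s sP] [t tP] /= st.
have {}st : s = t by apply: functional_extensionality_dep.
by case: _ / st tP => tP; congr NatTrans; apply: Prop_irrelevance.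
Qed.

Section NatTransOps.
Variables (C D : category).

Lemma nattrans_id_nat (F : functor C D) (x y : C) (f : hom x y) :
  fmap F f \;o idm (F x) = idm (F y) \;o fmap F f.
Proof. by rewrite comp1m compm1. Qed.

Definition nattrans_id (F : functor C D) : nattrans F F :=
  NatTrans (@nattrans_id_nat F).

Lemma nattrans_comp_nat (F G H : functor C D) (t : nattrans G H)
    (s : nattrans F G) (x y : C) (f : hom x y) :
  fmap H f \;o (t x \;o s x) = (t y \;o s y) \;o fmap F f.
Proof. by rewrite compmA naturality -compmA naturality compmA. Qed.

Definition nattrans_comp (F G H : functor C D) (t : nattrans G H)
    (s : nattrans F G) : nattrans F H :=
  NatTrans (nattrans_comp_nat t s).

Definition naturally_isomorphic (F G : functor C D) : Prop :=
  exists t : nattrans F G, forall x, is_iso (t x).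
End NatTransOps.

Definition equivalent_categories (C D : category) : Prop :=
  exists (F : functor C D) (G : functor D C),
    naturally_isomorphic (functor_comp G F) (functor_id C) /\
    naturally_isomorphic (functor_comp F G) (functor_id D).

Lemma linear_ext (R : pzRingType) (U V : lmodType R) (f g : {linear U -> V}) :
  f =1 g -> f = g.
Proof.
case: f g => [f [[fA] [fL]]] [g [[gA] [gL]]] /= /funext fg.
case: _ / fg gA gL => gA gL.
by rewrite (Prop_irrelevance fA gA) (Prop_irrelevance fL gL).
Qed.

Section Vect.
Variable k : fieldType.

Definition vect : category.
Proof.
refine (@Category (lmodType k) (fun U V => {linear U -> V})
  (fun U => idfun) (fun U V W g f => g \o f) _ _ _).
- by move=> U V f; apply: linear_ext.
- by move=> U V f; apply: linear_ext.
- by move=> U V W X h g f; apply: linear_ext.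
Defined.
End Vect.

Record kcategory (k : fieldType) := KCategory {
  kobj :> Type;
  khom : kobj -> kobj -> lmodType k;
  kid : forall x, khom x x;
  kcomp : forall x y z, khom y z -> khom x y -> khom x z;
  kcomp_linearl : forall x y z (f : khom x y),
    linear (fun g : khom y z => kcomp g f);
  kcomp_linearr : forall x y z (g : khom y z),
    linear (fun f : khom x y => kcomp g f);
  kcomp1m : forall x y (f : khom x y), kcomp (kid y) f = f;
  kcompm1 : forall x y (f : khom x y), kcomp f (kid x) = f;
  kcompmA : forall x y z t (h : khom z t) (g : khom y z) (f : khom x y),
    kcomp h (kcomp g f) = kcomp (kcomp h g) f
}.

Definition kcategory_category (k : fieldType) (C : kcategory k) : category :=
  @Category C (fun x y => khom x y) (@kid k C) (@kcomp k C)
    (@kcomp1m k C) (@kcompm1 k C) (@kcompmA k C).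

(* The vector space structure on [hom (F x) (F y)] in [vect k] is the pointwise
   one, so linearity of [F] on morphism spaces is tested pointwise. *)
Record kcat_module (k : fieldType) (C : kcategory k) := KCatModule {
  kcat_functor :> functor (kcategory_category C) (vect k);
  kcat_functor_linear : forall (x y : C) (c : k) (f g : khom x y)
      (v : (kcat_functor x : lmodType k)),
    (fmap kcat_functor (c *: f + g : khom x y) : {linear _ -> _}) v =
    c *: (fmap kcat_functor f : {linear _ -> _}) v +
    (fmap kcat_functor g : {linear _ -> _}) v
}.

Section KCatModules.
Variables (k : fieldType) (C : kcategory k).

Definition kcat_modules : category.
Proof.
refine (@Category (kcat_module C) (fun F G => nattrans F G)
  (fun F => nattrans_id F) (fun F G H t s => nattrans_comp t s) _ _ _).
- by move=> F G t; apply: nattrans_ext => x; apply: comp1m.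
- by move=> F G t; apply: nattrans_ext => x; apply: compm1.
- by move=> F G H K u t s; apply: nattrans_ext => x; apply: compmA.
Defined.
End KCatModules.

(* Associative algebras without unit; [algType k] is unital. *)
Record assoc_algebra (k : fieldType) := AssocAlgebra {
  alg_sort :> lmodType k;
  amul : alg_sort -> alg_sort -> alg_sort;
  amul_linearl : forall b, linear (fun a => amul a b);
  amul_linearr : forall a, linear (fun b => amul a b);
  amulA : forall a b c, amul a (amul b c) = amul (amul a b) c
}.
Notation "a ** b" := (amul a b) (at level 40, left associativity) : ring_scope.

(* The set of idempotents is presented as a family indexed by [L], possibly
   with repetitions. *)
Record local_units (k : fieldType) (A : assoc_algebra k) (L : Type) :=
LocalUnits {
  lunit :> L -> A;
  lunit_idem : forall l, lunit l ** lunit l = lunit l;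
  lunit_local : forall F : seq A,
    exists l, forall a, a \in F -> lunit l ** a = a /\ a ** lunit l = a
}.

Record alg_module (k : fieldType) (A : assoc_algebra k) := AlgModule {
  mod_sort :> lmodType k;
  act : A -> mod_sort -> mod_sort;
  act_linearl : forall m, linear (fun a => act a m);
  act_linearr : forall a, linear (fun m => act a m);
  actA : forall a b m, act a (act b m) = act (a ** b) m
}.

(* [A M] is the span of the products [a m], and that set of finite sums is
   already closed under scalars. *)
Definition unital (k : fieldType) (A : assoc_algebra k) (M : alg_module A) :
    Prop :=
  forall m : M, exists (n : nat) (a : 'I_n -> A) (x : 'I_n -> M),
    m = \sum_(i < n) act (a i) (x i).

Record unital_module (k : fieldType) (A : assoc_algebra k) := UnitalModule {
  umod :> alg_module A;
  umodP : unital umod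
}.

Record alg_hom (k : fieldType) (A : assoc_algebra k) (M N : alg_module A) :=
AlgHom {
  alg_hom_fun :> {linear M -> N};
  alg_homP : forall a m, alg_hom_fun (act a m) = act a (alg_hom_fun m)
}.

Section UnitalModules.
Variables (k : fieldType) (A : assoc_algebra k).
Implicit Types M N P : alg_module A.

Lemma alg_hom_ext M N (f g : alg_hom M N) : f =1 g -> f = g.
Proof.
case: f g => [f fP] [g gP] /= /linear_ext fg.
by case: _ / fg gP => gP; congr AlgHom; apply: Prop_irrelevance.
Qed.

Definition alg_hom_id M : alg_hom M M :=
  @AlgHom k A M M idfun (fun _ _ => erefl).

Lemma alg_hom_compP M N P (g : alg_hom N P) (f : alg_hom M N) a m :
  (g \o f) (act a m) = act a ((g \o f) m).
Proof. by rewrite /= !alg_homP. Qed.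

Definition alg_hom_comp M N P (g : alg_hom N P) (f : alg_hom M N) :
    alg_hom M P :=
  @AlgHom k A M P (alg_hom_fun g \o alg_hom_fun f) (alg_hom_compP g f).

Definition unital_modules : category.
Proof.
refine (@Category (unital_module A) (fun U V => alg_hom U V)
  (fun U => alg_hom_id U) (fun U V W g f => alg_hom_comp g f) _ _ _).
- by move=> U V f; apply: alg_hom_ext.
- by move=> U V f; apply: alg_hom_ext.
- by move=> U V W X h g f; apply: alg_hom_ext.
Defined.
End UnitalModules.

Section Corner.
Variables (k : fieldType) (A : assoc_algebra k).

(* The subspace [f A e] of [A]. *)
Definition in_corner (f e : A) : {pred A} :=
  fun x => `[< exists a : A, x = f ** a ** e >].

Lemma in_cornerP (f e x : A) :
  reflect (exists a : A, x = f ** a ** e) (x \in in_corner f e).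
Proof. exact: asboolP. Qed.

Lemma amul0l (a : A) : 0 ** a = 0.
Proof.
by have := amul_linearl a (-1) 0 0; rewrite scaler0 addr0 scaleN1r addNr.
Qed.

Lemma amul0r (a : A) : a ** 0 = 0.
Proof.
by have := amul_linearr a (-1) 0 0; rewrite scaler0 addr0 scaleN1r addNr.
Qed.

Lemma in_corner_submod_closed (f e : A) : submod_closed (in_corner f e).
Proof.
split=> [|c x y /in_cornerP[a ->] /in_cornerP[b ->]].
  by apply/in_cornerP; exists 0; rewrite amul0r amul0l.
by apply/in_cornerP; exists (c *: a + b); rewrite amul_linearr amul_linearl.
Qed.

HB.instance Definition _ (f e : A) :=
  GRing.isSubmodClosed.Build k A (in_corner f e) (in_corner_submod_closed f e).

Record corner (f e : A) := Corner {
  corner_val :> A;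
  _ : corner_val \in in_corner f e
}.

HB.instance Definition _ (f e : A) := [isSub for @corner_val f e].
HB.instance Definition _ (f e : A) := [Choice of corner f e by <:].
HB.instance Definition _ (f e : A) :=
  [SubChoice_isSubLmodule of corner f e by <:].

Lemma corner_idP (e : A) : e ** e = e -> e \in in_corner e e.
Proof. by move=> ee; apply/in_cornerP; exists e; rewrite !ee. Qed.

Lemma corner_mulP (h f e : A) (x : corner h f) (y : corner f e) :
  (x : A) ** (y : A) \in in_corner h e.
Proof.
case: x y => [x xP] [y yP] /=.
case/in_cornerP: xP => a ->; case/in_cornerP: yP => b ->.
by apply/in_cornerP; exists (a ** f ** f ** b); rewrite !amulA.
Qed.

Definition corner_mul (h f e : A) (x : corner h f) (y : corner f e) :
  corner h e := Corner (corner_mulP x y).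
End Corner.

Section LocalUnitsCategory.
Variables (k : fieldType) (A : assoc_algebra k) (L : Type) (S : local_units A L).

Definition local_units_category : kcategory k.
Proof.
refine (@KCategory k L (fun x y => corner (S y) (S x))
  (fun x => Corner (corner_idP (lunit_idem S x)))
  (fun x y z g f => corner_mul g f) _ _ _ _ _).
- by move=> x y z f c g g'; apply: val_inj; apply: amul_linearl.
- by move=> x y z g c f f'; apply: val_inj; apply: amul_linearr.
- move=> x y f; apply: val_inj; case: f => f fP /=.
  by case/in_cornerP: fP => a ->; rewrite !amulA lunit_idem.
- move=> x y f; apply: val_inj; case: f => f fP /=.
  by case/in_cornerP: fP => a ->; rewrite -!amulA lunit_idem.
- by move=> x y z t h g f; apply: val_inj; apply: amulA.
Defined.
End LocalUnitsCategory.

(* Main.v *)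
(* A unital module M gives the functor l |-> e_l M, on which e_m A e_l acts by
   multiplication. Conversely, a functor X gives the colimit of the X l along the
   morphisms e_l : l -> m for e_l = e_m e_l = e_l e_m, a directed system because
   the units are local. A quotient is avoided by embedding this colimit in the
   product of all X m, the class of x in X l being the family X(e_m e_l) x: this
   is injective since for m above l the entry X(e_m e_l) x is the transition map.
   An element a = a e_n acts on a family u by (a u)_m = X(e_m a e_n) u_n. The unit
   sends x in M to the family (e_m x)_m, and the counit evaluates at l a family
   fixed by e_l, which is the family generated by its entry at l. *)
From HB Require Import structures.
From mathcomp Require Import all_boot all_algebra.
From mathcomp Require Import boolp.
Require Import Defs.

Set Implicit Arguments.
Unset Strict Implicit.
Unset Printing Implicit Defensive.

Import GRing.Theory.
Local Open Scope ring_scope.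
Local Open Scope category_scope.

(** * Choice, and criteria for isomorphism in the categories involved *)

Lemma dependent_choice (I : Type) (V : I -> Type) (P : forall i, V i -> Prop) :
  (forall i, exists v, P i v) -> exists f : forall i, V i, forall i, P i (f i).
Proof. by move=> PV; exists (fun i => projT1 (cid (PV i))) => i; case: cid. Qed.

(** The unit is easiest to define out of the identity functor, while [equivalent_categories] asks
    for the transformation into it. Conjugating the naturality squares by the inverses of the
    components reverses the direction. *)
Lemma naturally_isomorphic_sym (C D : category) (F G : functor C D) :
  naturally_isomorphic F G -> naturally_isomorphic G F.
Proof.
case=> t /dependent_choice[s /all_and2[st ts]].
have sP x y (f : hom x y) : fmap F f \;o s x = s y \;o fmap G f.
  by rewrite -[LHS]comp1m -st -compmA [t y \;o _]compmA -naturality -!compmA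
             ts compm1.
by exists (NatTrans sP) => x; exists (t x).
Qed.

Lemma inj_surj_bij (T T' : Type) (f : T -> T') :
  injective f -> (forall y, exists x, f x = y) -> bijective f.
Proof.
by move=> fI /choice[g fK]; exists g => // x; apply: fI; rewrite fK.
Qed.

Lemma vect_is_iso (k : fieldType) (U V : lmodType k) (f : {linear U -> V}) :
  bijective f -> @is_iso (vect k) U V f.
Proof.
case=> g fK gK; pose gL := GRing.isLinear.Build _ _ _ _ g (can2_linear fK gK).
exists (HB.pack_for {linear V -> U} g gL : {linear V -> U});
by split; apply: linear_ext => x /=; rewrite ?fK ?gK.
Qed.

Lemma unital_modules_is_iso (k : fieldType) (A : assoc_algebra k)
    (M N : unital_module A) (f : alg_hom M N) :
  bijective f -> @is_iso (unital_modules A) M N f.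
Proof.
move=> /[dup] -[g fK gK] /vect_is_iso[h [hf fh]].
have {}hf x : (h : {linear N -> M}) (f x) = x.
  by have /(congr1 (fun h' : {linear M -> M} => h' x)) := hf.
have {}fh x : f ((h : {linear N -> M}) x) = x.
  by have /(congr1 (fun h' : {linear N -> N} => h' x)) := fh.
have hP a x : (h : {linear N -> M}) (act a x) = act a ((h : {linear _ -> _}) x).
  by rewrite -[x in LHS]fh -alg_homP hf.
by exists (AlgHom hP); split; apply: alg_hom_ext.
Qed.

Lemma kcat_modules_is_iso (k : fieldType) (C : kcategory k)
    (X Y : kcat_module C) (t : nattrans X Y) :
  (forall x, bijective (t x : {linear _ -> _})) ->
  @is_iso (kcat_modules C) X Y t.
Proof.
move=> tB.
have /dependent_choice[s /all_and2[st ts]] := fun x => vect_is_iso (tB x).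
have sP x y (f : @hom (kcategory_category C) x y) :
    fmap X f \;o s x = s y \;o fmap Y f.
  by rewrite -[LHS](comp1m (c := vect k)) -st -compmA [t y \;o _]compmA
             -naturality -!compmA ts compm1.
by exists (NatTrans sP); split; apply: nattrans_ext.
Qed.

(** * Products of families of modules over a ring *)

Section DependentProduct.
Variables (R : pzRingType) (I : Type) (V : I -> lmodType R).

(** A named copy of the product type, to which the algebraic instances can be attached; its equality
    and choice structures are classical. *)
Definition dep_prod := forall i, V i.
Implicit Types u v w : dep_prod.

HB.instance Definition _ := gen_eqMixin dep_prod.
HB.instance Definition _ := gen_choiceMixin dep_prod.

Let addA : associative (fun u v => (fun i => u i + v i) : dep_prod).
Proof.
by move=> u v w; apply: functional_extensionality_dep => i; apply: addrA.
Qed.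
Let addC : commutative (fun u v => (fun i => u i + v i) : dep_prod).
Proof. by move=> u v; apply: functional_extensionality_dep => i; apply: addrC. Qed.
Let add0 : left_id ((fun=> 0) : dep_prod) (fun u v => (fun i => u i + v i)).
Proof. by move=> u; apply: functional_extensionality_dep => i; apply: add0r. Qed.
Let addN : left_inverse ((fun=> 0) : dep_prod) (fun u i => - u i)
  (fun u v => (fun i => u i + v i)).
Proof. by move=> u; apply: functional_extensionality_dep => i; apply: addNr. Qed.

HB.instance Definition _ := GRing.isZmodule.Build dep_prod addA addC add0 addN.

Let scaleA (a b : R) u :
  (fun i => a *: (b *: u i)) = (fun i => (a * b) *: u i) :> dep_prod.
Proof. by apply: functional_extensionality_dep => i; apply: scalerA. Qed.
Let scale1 : left_id 1 (fun a u => (fun i => a *: u i) : dep_prod).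
Proof.
by move=> u; apply: functional_extensionality_dep => i; apply: scale1r.
Qed.
Let scaleDr : right_distributive (fun a u => (fun i => a *: u i) : dep_prod) +%R.
Proof.
by move=> a u v; apply: functional_extensionality_dep => i; apply: scalerDr.
Qed.
Let scaleDl u : {morph (fun a => (fun i => a *: u i) : dep_prod) : a b / a + b}.
Proof.
by move=> a b; apply: functional_extensionality_dep => i; apply: scalerDl.
Qed.

HB.instance Definition _ :=
  GRing.Zmodule_isLmodule.Build R dep_prod scaleA scale1 scaleDr scaleDl.

Lemma dep_prodD u v i : (u + v) i = u i + v i. Proof. by []. Qed.
Lemma dep_prodZ a u i : (a *: u) i = a *: u i. Proof. by []. Qed.
End DependentProduct.

(** * From modules to functors: the pieces e M *)

Section ModuleToFunctor.
Variables (k : fieldType) (A : assoc_algebra k).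

Section Fixed.
Variable M : alg_module A.

HB.instance Definition _ (a : A) :=
  GRing.isLinear.Build k M M *:%R (act a) (@act_linearr k A M a).

(** For idempotent e the fixed vectors form exactly e M; the equation form makes membership and
    closure immediate. *)
Definition fixed_by (e : A) : {pred M} := fun m => act e m == m.

Lemma fixed_byP (e : A) (m : M) : reflect (act e m = m) (m \in fixed_by e).
Proof. exact: eqP. Qed.

Lemma fixed_by_submod_closed (e : A) : submod_closed (fixed_by e).
Proof.
split=> [|c m n /fixed_byP em /fixed_byP en]; apply/fixed_byP.
  exact: linear0.
by rewrite act_linearr em en.
Qed.

HB.instance Definition _ (e : A) :=
  GRing.isSubmodClosed.Build k M (fixed_by e) (fixed_by_submod_closed e).

Record fixed (e : A) := Fixed {
  fixed_val :> M;
  _ : fixed_val \in fixed_by e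
}.

HB.instance Definition _ (e : A) := [isSub for @fixed_val e].
HB.instance Definition _ (e : A) := [Choice of fixed e by <:].
HB.instance Definition _ (e : A) := [SubChoice_isSubLmodule of fixed e by <:].

Lemma fixedP (e : A) (m : fixed e) : act e m = m.
Proof. by case: m => m /= /fixed_byP. Qed.

Lemma act_fixed (e a : A) (m : M) : e ** a = a -> act a m \in fixed_by e.
Proof. by move=> ea; apply/fixed_byP; rewrite actA ea. Qed.
End Fixed.

Variables (L : Type) (S : local_units A L).
Local Notation C := (local_units_category S).

Lemma lunit_corner (x y : L) (a : corner (S y) (S x)) :
  S y ** a = a /\ a ** S x = a.
Proof.
case: a => a /= /in_cornerP[b ->].
by rewrite -[_ ** S x ** S x]amulA lunit_idem !amulA lunit_idem.
Qed.

Definition corner_act (M : alg_module A) (x y : L) (a : corner (S y) (S x))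
    (m : fixed M (S x)) : fixed M (S y) :=
  Fixed (act_fixed m (proj1 (lunit_corner a))).

Lemma corner_act_linear M x y (a : corner (S y) (S x)) :
  linear (@corner_act M x y a).
Proof. by move=> c m n; apply: val_inj; apply: act_linearr. Qed.

HB.instance Definition _ M x y (a : corner (S y) (S x)) :=
  GRing.isLinear.Build k (fixed M (S x)) (fixed M (S y)) *:%R
    (corner_act a) (@corner_act_linear M x y a).

Definition pieces_functor (M : alg_module A) :
  functor (kcategory_category C) (vect k).
Proof.
refine (@Functor (kcategory_category C) (vect k)
  (fun x => fixed M (S x) : lmodType k)
  (fun x y a => corner_act a : {linear fixed M (S x) -> fixed M (S y)}) _ _).
- by move=> x; apply: linear_ext => m; apply: val_inj; apply: fixedP.
- by move=> x y z b a; apply: linear_ext => m; apply: val_inj; rewrite /= actA.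
Defined.

Definition pieces (M : alg_module A) : kcat_module C.
Proof.
by refine (@KCatModule k C (pieces_functor M) _) => x y c a b m;
   apply: val_inj; apply: act_linearl.
Defined.

Lemma alg_hom_fixed (M N : alg_module A) (f : alg_hom M N) (e : A)
  (m : fixed M e) : f (fixed_val m) \in fixed_by e.
Proof. by apply/fixed_byP; rewrite -alg_homP fixedP. Qed.

Definition fixed_map (M N : alg_module A) (f : alg_hom M N) (e : A)
  (m : fixed M e) : fixed N e := Fixed (alg_hom_fixed f m).

Lemma fixed_map_linear M N (f : alg_hom M N) e : linear (@fixed_map M N f e).
Proof. by move=> c m n; apply: val_inj; rewrite /= linearP. Qed.

HB.instance Definition _ M N (f : alg_hom M N) e :=
  GRing.isLinear.Build k (fixed M e) (fixed N e) *:%R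
    (@fixed_map M N f e) (@fixed_map_linear M N f e).

Definition pieces_map (M N : alg_module A) (f : alg_hom M N) :
  nattrans (pieces M) (pieces N).
Proof.
refine (@NatTrans (kcategory_category C) (vect k) (pieces M) (pieces N)
  (fun x => @fixed_map M N f (S x) : {linear _ -> _}) _).
by move=> x y a; apply: linear_ext => m; apply: val_inj; rewrite /= alg_homP.
Defined.

Definition pieces_on_modules : functor (unital_modules A) (kcat_modules C).
Proof.
refine (@Functor (unital_modules A) (kcat_modules C)
  (fun M => pieces M) (fun M N f => pieces_map f) _ _).
- by move=> M; apply: nattrans_ext => x; apply: linear_ext => m; apply: val_inj.
- by move=> M N P g f; apply: nattrans_ext => x; apply: linear_ext => m;
     apply: val_inj.
Defined.
End ModuleToFunctor.

(** * From functors to unital modules: the colimit and its action of [A] *)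

Section FunctorToModule.
Variables (k : fieldType) (A : assoc_algebra k) (L : Type) (S : local_units A L).
Local Notation C := (local_units_category S).

Lemma compress_in_corner (l m : L) (a : A) :
  S m ** a ** S l \in in_corner (S m) (S l).
Proof. by apply/in_cornerP; exists a. Qed.

Definition compress (l m : L) (a : A) : @khom k C l m :=
  Corner (compress_in_corner l m a).

Section Action.
Variable X : kcat_module C.
Local Notation "X @ l" := (kcat_functor X l : lmodType k) (at level 10).

(* A total extension of the action of [X]: it applies [X] to [e_m a e_l]. *)
Definition kact (l m : L) (a : A) : {linear X @ l -> X @ m} :=
  @fmap _ _ X l m (compress l m a).

(** Elements of e_m A e_l are unchanged by compression, so the extension agrees with [X] on
    morphisms. *)
Lemma kactE (l m : L) (a : @khom k C l m) (x : X @ l) :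
  (@fmap _ _ X l m a : {linear X @ l -> X @ m}) x = kact l m (corner_val a) x.
Proof.
congr ((@fmap _ _ X l m _ : {linear X @ l -> X @ m}) x).
by apply: val_inj => /=; have [-> ->] := lunit_corner a.
Qed.

(** The middle unit remains because (e_n b e_m)(e_m a e_l) = e_n (b e_m a) e_l. *)
Lemma kact_comp (l m n : L) (a b : A) (x : X @ l) :
  kact m n b (kact l m a x) = kact l n (b ** S m ** a) x.
Proof.
have /(congr1 (fun h : {linear X @ l -> X @ n} => h x)) /= <- :=
  @fmapM _ _ X l m n (compress m n b) (compress l m a).
rewrite /kact; congr ((@fmap _ _ X l n _ : {linear X @ l -> X @ n}) x).
by apply: val_inj; rewrite /= !amulA -[_ ** S m ** S m]amulA lunit_idem.
Qed.

Lemma kact_unitr (l m : L) (a : A) (x : X @ l) :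
  kact l m (a ** S l) x = kact l m a x.
Proof.
congr ((@fmap _ _ X l m _ : {linear X @ l -> X @ m}) x).
by apply: val_inj; rewrite /= -!amulA lunit_idem.
Qed.

Lemma kact_id (l : L) (x : X @ l) : kact l l (S l) x = x.
Proof.
have /(congr1 (fun h : {linear X @ l -> X @ l} => h x)) /= := @fmap1 _ _ X l.
by rewrite kactE.
Qed.

Lemma kact_linearl (l m : L) (x : X @ l) : linear (fun a => kact l m a x).
Proof.
move=> c a b; rewrite /kact -kcat_functor_linear.
congr ((@fmap _ _ X l m _ : {linear X @ l -> X @ m}) x).
by apply: val_inj; rewrite /= amul_linearr amul_linearl.
Qed.

Definition families := dep_prod (fun l : L => X @ l).
Implicit Types u v : families.

(* [kact l m (S l)] is [X] applied to [e_m e_l]. *)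
Definition generated_at (u : families) (l : L) : Prop :=
  forall m, u m = kact l m (S l) (u l).

Definition germ : {pred families} := fun u => `[< exists l, generated_at u l >].

Lemma germP u : reflect (exists l, generated_at u l) (u \in germ).
Proof. exact: asboolP. Qed.

(** Going from l to m through n applies X to e_m e_n e_l, which equals e_m e_l. *)
Lemma generated_at_mono u l n :
  S n ** S l = S l -> generated_at u l -> generated_at u n.
Proof.
by move=> nl ul m; rewrite ul [u n]ul kact_comp lunit_idem nl.
Qed.

(** Directedness of the system: a local unit for e_l and e_l' lies above both indices. *)
Lemma generated_at_common u v :
  u \in germ -> v \in germ -> exists n, generated_at u n /\ generated_at v n.
Proof.
move=> /germP[l ul] /germP[l' vl'].
have [n nP] := lunit_local S [:: S l; S l'].
exists n; split; [apply: generated_at_mono ul|apply: generated_at_mono vl'].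
  by apply: proj1 (nP _ _); rewrite inE eqxx.
by apply: proj1 (nP _ _); rewrite !inE eqxx orbT.
Qed.

Lemma germ_submod_closed : submod_closed germ.
Proof.
split=> [|c u v uP vP]; apply/germP.
  (* A local unit for the empty set supplies an index, where the zero family is generated. *)
  have [l _] := lunit_local S [::]; exists l => m.
  by rewrite [RHS]linear0.
have [n [un vn]] := generated_at_common uP vP; exists n => m.
by rewrite !dep_prodD !dep_prodZ linearP -un -vn.
Qed.

HB.instance Definition _ :=
  GRing.isSubmodClosed.Build k families germ germ_submod_closed.

Record colim := Colim { colim_val :> families; _ : colim_val \in germ }.

HB.instance Definition _ := [isSub for colim_val].
HB.instance Definition _ := [Choice of colim by <:].
HB.instance Definition _ := [SubChoice_isSubLmodule of colim by <:].

Lemma colimP (u : colim) : exists l, generated_at u l.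
Proof. by case: u => u /= /germP. Qed.

Lemma colim_eq (u v : colim) :
  (forall m, colim_val u m = colim_val v m) -> u = v.
Proof. by move=> uv; apply: val_inj; apply: functional_extensionality_dep. Qed.

Definition unit_of (a : A) : L := projT1 (cid (lunit_local S [:: a])).

Lemma unit_ofP a : S (unit_of a) ** a = a /\ a ** S (unit_of a) = a.
Proof. by rewrite /unit_of; case: cid => n; apply; rewrite inE. Qed.

(* [u] need not be generated at [unit_of a], but its value there determines
   the result because [a = a e] for that unit [e]; this makes the action visibly
   linear in [u]. *)
Definition family_act (a : A) (u : families) : families :=
  fun m => kact (unit_of a) m a (u (unit_of a)).

(** With n the chosen unit, a e_n e_l = a e_l, so the choice disappears. Evaluating at a generating
    index, which depends on [u] only, gives linearity in [a] although [unit_of a] varies. *)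
Lemma family_actE a u l m :
  generated_at u l -> family_act a u m = kact l m a (u l).
Proof.
by move=> ul; rewrite /family_act ul kact_comp (proj2 (unit_ofP a)) kact_unitr.
Qed.

Lemma family_act_generated a u l n :
  generated_at u l -> S n ** a = a -> generated_at (family_act a u) n.
Proof.
by move=> ul na m; rewrite !(family_actE _ _ ul) kact_comp lunit_idem na.
Qed.

Lemma family_act_germ a (u : colim) : family_act a u \in germ.
Proof.
have [l ul] := colimP u; apply/germP; exists (unit_of a).
by apply: family_act_generated ul _; case: (unit_ofP a).
Qed.

Definition colim_act (a : A) (u : colim) : colim := Colim (family_act_germ a u).

Lemma colim_act_linearl (u : colim) : linear (fun a => colim_act a u).
Proof.
move=> c a b; have [l ul] := colimP u; apply: colim_eq => m.
change (family_act (c *: a + b) u m =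
        c *: family_act a u m + family_act b u m).
by rewrite !(family_actE _ _ ul) kact_linearl.
Qed.

Lemma colim_act_linearr (a : A) : linear (colim_act a).
Proof. by move=> c u v; apply: colim_eq => m; apply: linearP. Qed.

Lemma colim_actA (a b : A) (u : colim) :
  colim_act a (colim_act b u) = colim_act (a ** b) u.
Proof.
have [l ul] := colimP u; have [nb _] := unit_ofP b; apply: colim_eq => m /=.
(* The family b u is generated at the unit n chosen for b, so the outer action may be evaluated
   there; then a e_n b = a b. *)
rewrite (family_actE _ _ (family_act_generated ul nb)) !(family_actE _ _ ul).
by rewrite kact_comp -amulA nb.
Qed.

Definition colim_alg_module : alg_module A :=
  AlgModule colim_act_linearl colim_act_linearr colim_actA.

(** This identifies the piece of the colimit at l with the families generated at l, which their
    entry at l determines; both unitality and the counit rest on it. *)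
Lemma colim_act_unit (u : colim) l : colim_act (S l) u = u <-> generated_at u l.
Proof.
split=> [lu m|ul]; last first.
  by apply: colim_eq => m; rewrite /= (family_actE _ _ ul) -ul.
have [s us] := colimP u.
rewrite -{1}lu /= (family_actE _ _ us) [colim_val u l]us kact_comp lunit_idem.
by rewrite kact_unitr.
Qed.

Lemma colim_unital : unital colim_alg_module.
Proof.
move=> u; have [l /colim_act_unit lu] := colimP u.
by exists 1, (fun=> S l), (fun=> u); rewrite big_ord1 /= lu.
Qed.

Definition colim_module : unital_module A := UnitalModule colim_unital.
End Action.

Lemma kact_natural (X Y : kcat_module C) (t : nattrans X Y) (l m : L) (a : A)
    (x : kcat_functor X l : lmodType k) :
  (t m : {linear _ -> _}) (kact X l m a x) =
  kact Y l m a ((t l : {linear _ -> _}) x).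
Proof.
have := naturality t (compress l m a).
by move/(congr1 (fun h : {linear _ -> _} => h x)).
Qed.
End FunctorToModule.
Arguments germ {k A L S X}.

(** * Functoriality of the colimit, the unit and the counit *)

Section Equivalence.
Variables (k : fieldType) (A : assoc_algebra k) (L : Type) (S : local_units A L).
Local Notation C := (local_units_category S).

(** A local unit for the finitely many coefficients in an expression of m as a sum of products fixes
    m. *)
Lemma unital_fixed (M : unital_module A) (m : M) : exists l, act (S l) m = m.
Proof.
have [n [a [x ->]]] := umodP m; have [l lP] := lunit_local S (codom a).
exists l; rewrite linear_sum; apply: eq_bigr => i _ /=.
by rewrite actA (proj1 (lP _ (codom_f a i))).
Qed.

Section ColimMap.
Variables (X Y : kcat_module C) (t : nattrans X Y).

Definition family_map (u : families X) : families Y :=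
  fun m => (t m : {linear _ -> _}) (u m).

Lemma family_map_generated u l :
  generated_at u l -> generated_at (family_map u) l.
Proof. by move=> ul m; rewrite /family_map ul kact_natural. Qed.

Lemma family_map_germ (u : colim X) : family_map u \in germ.
Proof.
by have [l ul] := colimP u; apply/germP; exists l; apply: family_map_generated.
Qed.

Definition colim_map_fun (u : colim X) : colim Y := Colim (family_map_germ u).

Lemma colim_map_linear : linear colim_map_fun.
Proof. by move=> c u v; apply: colim_eq => m; apply: linearP. Qed.

HB.instance Definition _ :=
  GRing.isLinear.Build k (colim X) (colim Y) *:%R colim_map_fun colim_map_linear.

Lemma colim_map_act (a : A) (u : colim X) :
  colim_map_fun (colim_act a u) = colim_act a (colim_map_fun u).
Proof. by apply: colim_eq => m; rewrite /= /family_map kact_natural. Qed.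

Definition colim_map : alg_hom (colim_alg_module X) (colim_alg_module Y) :=
  @AlgHom k A (colim_alg_module X) (colim_alg_module Y)
    colim_map_fun colim_map_act.
End ColimMap.

Definition colim_functor : functor (kcat_modules C) (unital_modules A).
Proof.
refine (@Functor (kcat_modules C) (unital_modules A)
  (fun X => colim_module X) (fun X Y t => colim_map t) _ _).
- by move=> X; apply: alg_hom_ext => u; apply: colim_eq.
- by move=> X Y Z t s; apply: alg_hom_ext => u; apply: colim_eq.
Defined.

Section Unit.
Variable M : unital_module A.

(** The right factor e_l of the compression is absorbed, since x is fixed by it. *)
Lemma kact_pieces (l m : L) (a : A) (x : fixed M (S l)) :
  fixed_val (kact (pieces S M) l m a x) = act (S m ** a) x.
Proof. by rewrite /= -actA fixedP. Qed.

Definition cut_family (x : M) : families (pieces S M) :=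
  fun l => Fixed (act_fixed x (lunit_idem S l)).

Lemma cut_generated x l : act (S l) x = x -> generated_at (cut_family x) l.
Proof.
by move=> lx m; apply: val_inj; rewrite [RHS]kact_pieces -actA /= !lx.
Qed.

Lemma cut_germ (x : M) : cut_family x \in germ.
Proof. by apply/germP; have [l /cut_generated] := unital_fixed x; exists l. Qed.

Definition cut_fun (x : M) : colim (pieces S M) := Colim (cut_germ x).

Lemma cut_linear : linear cut_fun.
Proof.
by move=> c x y; apply: colim_eq => m; apply: val_inj; apply: act_linearr.
Qed.

HB.instance Definition _ :=
  GRing.isLinear.Build k M (colim (pieces S M)) *:%R cut_fun cut_linear.

Lemma cut_act a (x : M) :
  cut_fun (act a x) = colim_act a (cut_fun x).
Proof.
apply: colim_eq => m; apply: val_inj; have [l lx] := unital_fixed x.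
rewrite [colim_val (colim_act _ _) m](family_actE _ _ (cut_generated lx)).
by rewrite [RHS]kact_pieces /= lx actA.
Qed.

Definition cut_hom : alg_hom M (colim_alg_module (pieces S M)) :=
  @AlgHom k A M (colim_alg_module (pieces S M)) cut_fun cut_act.

Lemma cut_hom_bij : bijective cut_hom.
Proof.
apply: inj_surj_bij => [|u].
  apply: raddf_inj => x x0.
  (* Some e_l fixes x, so x is itself the entry at l of its family, which is zero. *)
  have [l <-] := unital_fixed x.
  exact: (congr1 (fun u : colim (pieces S M) =>
    fixed_val (colim_val u l : fixed M (S l))) x0).
(* The preimage is the entry at a generating index l: its family has entries e_m u_l = e_m e_l u_l =
   u_m. *)
have [l ul] := colimP u; exists (fixed_val (colim_val u l : fixed M (S l))).
apply: colim_eq => m; apply: val_inj.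
by rewrite [in RHS]ul [RHS]kact_pieces -actA fixedP.
Qed.
End Unit.

Section Counit.
Variable X : kcat_module C.
Local Notation "X @ l" := (kcat_functor X l : lmodType k) (at level 10).

Definition eval_at (l : L) (u : fixed (colim_alg_module X) (S l)) : X @ l :=
  colim_val (fixed_val u) l.

Lemma eval_at_linear l : linear (@eval_at l).
Proof. by []. Qed.

HB.instance Definition _ l :=
  GRing.isLinear.Build k (fixed (colim_alg_module X) (S l)) (X @ l) *:%R
    (@eval_at l) (@eval_at_linear l).

Lemma fixed_generated l (u : fixed (colim_alg_module X) (S l)) :
  generated_at (colim_val (fixed_val u)) l.
Proof. by apply/colim_act_unit/(fixedP u). Qed.

Definition counit : nattrans (pieces S (colim_alg_module X)) X.
Proof.
refine (@NatTrans (kcategory_category C) (vect k)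
  (pieces S (colim_alg_module X)) X
  (fun l => @eval_at l : {linear _ -> _}) _).
move=> l m a; apply: linear_ext => u.
by rewrite /= [LHS]kactE [RHS](family_actE _ _ (fixed_generated u)).
Defined.

Lemma eval_at_bij l : bijective (@eval_at l).
Proof.
apply: inj_surj_bij => [|x].
  apply: raddf_inj => u ul0; apply: val_inj; apply: colim_eq => m.
  by rewrite (fixed_generated u) [colim_val _ l]ul0 linear0.
(* The preimage of x is the family it generates, whose entry at l is X(e_l) x = x. *)
pose u : families X := fun m => kact X l m (S l) x.
have ul : generated_at u l by move=> m; rewrite /u kact_id.
have uP : u \in germ by apply/germP; exists l.
have lu : (Colim uP : colim_alg_module X) \in fixed_by (S l).
  by apply/fixed_byP/colim_act_unit.
by exists (Fixed lu); apply: kact_id.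
Qed.
End Counit.

End Equivalence.

Theorem theorem73 (k : fieldType) (A : assoc_algebra k) (L : Type)
    (S : local_units A L) :
  equivalent_categories (unital_modules A)
    (kcat_modules (local_units_category S)).
Proof.
pose P := pieces_on_modules S; pose G := colim_functor S.
exists P, G; split.
  apply: naturally_isomorphic_sym; unshelve eexists.
    refine (@NatTrans _ _ (functor_id _) (functor_comp G P) (cut_hom S) _).
    (* Naturality of the unit is equivariance of f under each e_l. *)
    move=> M N f; apply: alg_hom_ext => x; apply: colim_eq => l.
    by apply: val_inj; rewrite /= alg_homP.
  by move=> M; apply/unital_modules_is_iso/cut_hom_bij.
unshelve eexists.
  refine (@NatTrans _ _ (functor_comp P G) (functor_id _) (@counit k A L S) _).
  by move=> X Y t; apply: nattrans_ext => l; apply: linear_ext.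
by move=> X; apply: kcat_modules_is_iso => l; apply: eval_at_bij.
Qed.
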